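(* Let $X$ be a uniformly discrete bounded geometry metric space admitting an injective uniform embedding into some countable discrete group $G$. Then $X$ admits a free and globally controlled atlas, and in particular $\kappa_X(R)=1$ for all $R>0$.
   Context: Countable discrete groups are equipped with a proper left-invariant metric (unique up to coarse equivalence). A map $\phi\colon X\to Y$ of metric spaces is a uniform embedding if for all $R$ there exists $S$ such that $d(x,y)\le R$ implies $d(\phi(x),\phi(y))\le S$, and for all $R$ there exists $S$ such that $d(\phi(x),\phi(y))\le R$ implies $d(x,y)\le S$. Let $(X,d)$ be a metric space. $X$ is uniformly discrete if there is $c>0$ with $d(x,y)\ge c$ for all distinct $x,y$; it has bounded geometry if for every $R>0$ there is $N$ such that every ball $B_R(x)$ has at most $N$ points. A partial bijection of $X$ is a subset $s\subseteq X\times X$ on which both coordinate projections to $X$ are injective; it is viewed as a partially defined injection, writing $x=s(y)$ (or $x=sy$) if $(x,y)\in s$. A partial translation of $X$ is a partial bijection $t$ such that $d(x,y)$ is bounded for $(x,y)\in t$. If $\mathcal{T}$ is a collection of (pairwise) disjoint partial translations of $X$, a partial bijection $\sigma$ is a partial cotranslation for $\mathcal{T}$ if for all $t\in\mathcal{T}$ and $(x,y)\in t$ such that $\sigma$ is defined on both $x$ and $y$, we have $(\sigma x,\sigma y)\in t$. An atlas on $X$ is a family $\mathcal{A}=\{(\mathcal{T}_R,\Sigma_R)\mid R>0\}$ where, for each $R>0$, $\mathcal{T}_R$ is a finite set of disjoint partial translations of $X$ and $\Sigma_R$ is a collection of partial cotranslations for $\mathcal{T}_R$ such that: (1) the union of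 the $t\in\mathcal{T}_R$ contains all $(x,y)\in X\times X$ with $d(x,y)<R$; (2) there exists $k$ such that for each $x,x'\in X$ there are at most $k$ elements $\sigma\in\Sigma_R$ with $\sigma x=x'$; (3) for each $t\in\mathcal{T}_R$ and all $(x,y),(x',y')\in t$ there exists $\sigma\in\Sigma_R$ with $\sigma x=x'$ and $\sigma y=y'$. Let $k_{\mathcal{A}}(R)$ be the smallest $k$ for which (2) holds. The atlas is free if $k_{\mathcal{A}}(R)=1$ for all $R>0$. It is globally controlled if for all $R>0$ and $x,y\in X$ the cotranslation orbit $\{(x',y') : \exists\,\sigma\in\Sigma_R,\ \sigma x=x',\ \sigma y=y'\}$ is a partial translation. For $X$ uniformly discrete of bounded geometry, $\kappa_X(R)$ is the minimum of $k_{\mathcal{A}}(R)$ over all atlases $\mathcal{A}$ on $X$. *)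

(* Defs.v *)
From HB Require Import structures.
From mathcomp Require Import all_boot all_order all_algebra.
From mathcomp Require Import all_classical all_reals.
From mathcomp Require Import topology.

Set Implicit Arguments.
Unset Strict Implicit.
Unset Printing Implicit Defensive.

Import Order.TTheory GRing.Theory Num.Theory.

Local Open Scope classical_set_scope.
Local Open Scope card_scope.
Local Open Scope ring_scope.

(* No compatibility is required between the group law and the metric; see
   [left_invariant]. *)
#[short(type="metricGroupType")]
HB.structure Definition MetricGroup (R : numDomainType) :=
  {G of Group G & Metric R G}.

Definition left_invariant (R : numDomainType) (G : metricGroupType R) : Prop :=
  forall g x y : G, mdist (g * x)%g (g * y)%g = mdist x y.

Definition proper_metric (R : numDomainType) (X : metricType R) : Prop :=
  forall (x : X) (r : R), compact [set y | mdist x y <= r].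

(* The topology of [G] is the metric one, so the second clause says that the
   metric induces the discrete topology. *)
Definition countable_discrete (R : numDomainType) (G : metricGroupType R) :
    Prop :=
  countable [set: G] /\ forall g : G, open [set g].

Definition uniform_embedding (R : numDomainType) (X Y : metricType R)
    (phi : X -> Y) : Prop :=
  (forall r : R, exists s : R, forall x y : X,
     mdist x y <= r -> mdist (phi x) (phi y) <= s) /\
  (forall r : R, exists s : R, forall x y : X,
     mdist (phi x) (phi y) <= r -> mdist x y <= s).

Definition uniformly_discrete (R : numDomainType) (X : metricType R) : Prop :=
  exists2 c : R, 0 < c & forall x y : X, x <> y -> c <= mdist x y.

Definition bounded_geometry (R : numDomainType) (X : metricType R) : Prop :=
  forall r : R, 0 < r -> exists N : nat, forall x : X, ball x r #<= `I_N.

Definition partial_bijection (X : Type) (s : set (X * X)) : Prop :=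
  set_inj s fst /\ set_inj s snd.

(* [sends s y x] is the assertion x = s(y): the argument is the second
   coordinate of the pair. *)
Definition sends (X : Type) (s : set (X * X)) (y x : X) : Prop := s (x, y).

Definition partial_translation (R : numDomainType) (X : metricType R)
    (t : set (X * X)) : Prop :=
  partial_bijection t /\
  exists C : R, forall x y : X, t (x, y) -> mdist x y <= C.

Definition partial_cotranslation (X : Type) (T : set (set (X * X)))
    (sigma : set (X * X)) : Prop :=
  partial_bijection sigma /\
  forall t, T t -> forall x y x' y' : X, t (x, y) ->
    sends sigma x x' -> sends sigma y y' -> t (x', y').

(* At most k elements of Sigma send x to x', for all x and x'. *)
Definition multiplicity_le (X : Type) (Sigma : set (set (X * X))) (k : nat) :
    Prop :=
  forall x x' : X, [set sigma | Sigma sigma /\ sends sigma x x'] #<= `I_k.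

(* The two families are indexed by all of R, but only their values at positive
   radii are constrained or used. *)
Record atlas (R : numDomainType) (X : metricType R) := Atlas {
  translations : R -> set (set (X * X));
  cotranslations : R -> set (set (X * X));
  atlas_finite : forall r, 0 < r -> finite_set (translations r);
  atlas_translation : forall r, 0 < r ->
    forall t, translations r t -> partial_translation t;
  atlas_disjoint : forall r, 0 < r -> trivIset (translations r) id;
  atlas_cotranslation : forall r, 0 < r ->
    forall sigma, cotranslations r sigma ->
      partial_cotranslation (translations r) sigma;
  atlas_cover : forall r, 0 < r ->
    forall x y : X, mdist x y < r -> exists2 t, translations r t & t (x, y);
  atlas_multiplicity : forall r, 0 < r ->
    exists k, multiplicity_le (cotranslations r) k;
  atlas_transitive : forall r, 0 < r ->
    forall t, translations r t -> forall x y x' y' : X,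
      t (x, y) -> t (x', y') ->
      exists2 sigma, cotranslations r sigma &
        sends sigma x x' /\ sends sigma y y'
}.

(* The value is 0 on the empty set. *)
Definition nat_min (S : set nat) : nat :=
  xget 0%N [set k | S k /\ forall j, S j -> (k <= j)%N].

Definition atlas_k (R : numDomainType) (X : metricType R) (A : atlas X)
    (r : R) : nat :=
  nat_min [set k | multiplicity_le (cotranslations A r) k].

Definition free_atlas (R : numDomainType) (X : metricType R) (A : atlas X) :
    Prop :=
  forall r : R, 0 < r -> atlas_k A r = 1%N.

Definition cotranslation_orbit (R : numDomainType) (X : metricType R)
    (A : atlas X) (r : R) (x y : X) : set (X * X) :=
  [set p | exists2 sigma, cotranslations A r sigma &
     sends sigma x p.1 /\ sends sigma y p.2].

Definition globally_controlled (R : numDomainType) (X : metricType R)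
    (A : atlas X) : Prop :=
  forall r : R, 0 < r -> forall x y : X,
    partial_translation (cotranslation_orbit A r x y).

(* If [X] had no atlas, the value would be 0. *)
Definition kappa (R : numDomainType) (X : metricType R) (r : R) : nat :=
  nat_min (range (fun A : atlas X => atlas_k A r)).

(* Main.v *)
Require Import Defs.
From HB Require Import structures.
From mathcomp Require Import all_boot all_order all_algebra.
From mathcomp Require Import all_classical all_reals.
From mathcomp Require Import topology.

Set Implicit Arguments.
Unset Strict Implicit.
Unset Printing Implicit Defensive.

Import Order.TTheory GRing.Theory Num.Theory.

Local Open Scope classical_set_scope.
Local Open Scope ring_scope.

(** The left and the right translations of a group commute. When the metric is
    left invariant, the right translation by h moves every point by the same
    distance d(1, h), and u^-1 v is the only h taking u to v; the left
    translations preserve u^-1 v, and each of them is determined by the image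
    of a single point. Pulling both back along phi gives, on X, the partial
    bijections [right_orbit phi h], which are disjoint and cover X * X, and the
    partial bijections [left_transport phi g], which preserve each of them.

    The atlas takes at radius r those [right_orbit phi h] that contain a pair at
    distance < r, and every [left_transport phi g]. Such an h lies in a ball of
    G about the identity, which is finite because it is compact and discrete, so
    there are finitely many translations. Given (x, y) and (x', y') with the
    same h, the element g = phi x' (phi x)^-1 carries the first pair to the
    second, and it is the only one carrying x to x': hence transitivity and
    multiplicity one. As left translations preserve h, a cotranslation orbit
    stays in a single [right_orbit phi h], which is global control.

    Finally, 1 is a lower bound of [atlas_k A r] for every atlas A of a nonempty
    space: a point x is at distance 0 from itself, so some translation contains
    (x, x), and transitivity yields a cotranslation fixing x. Hence the minimum
    over all atlases is attained by the one above. *)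

(** The points of A form an open cover of A with no proper subcover. *)
Lemma compact_discrete_finite (T : topologicalType) (A : set T) :
  (forall x : T, open [set x]) -> compact A -> finite_set A.
Proof.
move=> T_discrete A_compact; have [->//|/set0P[a Aa]] := eqVneq A set0.
(* Compactness agrees with the open-cover property on pointed spaces, and any
   point of A can serve as base point. *)
pose pT : ptopologicalType := HB.pack T (isPointed.Build T a).
have : @cover_compact pT A by rewrite -compact_cover.
case/(_ T A (fun x => [set x])) => [x _|x Ax|F _ AF]; first exact: T_discrete.
  by exists x.
apply: sub_finite_set (finite_fset F) => x /AF[y Fy /= ->].
exact: Fy.
Qed.

Lemma proper_discrete_ball_finite (R : numDomainType) (G : metricGroupType R)
    (r : R) :
  countable_discrete G -> proper_metric G ->
  finite_set [set h : G | mdist 1%g h <= r].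
Proof. by move=> [_ G_open] G_proper; exact: compact_discrete_finite. Qed.

Lemma nat_min_spec (S : set nat) :
  S !=set0 -> S (nat_min S) /\ forall j, S j -> (nat_min S <= j)%N.
Proof.
move=> [n Sn]; rewrite /nat_min.
have S_ex : exists n, `[< S n >] by exists n; apply/asboolP.
apply: (@xgetPex _ 0%N [set k | S k /\ forall j, S j -> (k <= j)%N]).
case: (ex_minnP S_ex) => k /asboolP Sk k_min.
by exists k; split=> // j Sj; apply/k_min/asboolP.
Qed.

Lemma nat_min_eq1 (S : set nat) :
  (forall j, S j -> (0 < j)%N) -> S 1%N -> nat_min S = 1%N.
Proof.
move=> S_gt0 S1; have [Smin min_le] := @nat_min_spec S (ex_intro _ _ S1).
by apply/eqP; rewrite eqn_leq min_le// S_gt0.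
Qed.

Lemma multiplicity_gt0 (X : Type) (Sigma : set (set (X * X))) (x x' : X)
    (sigma : set (X * X)) (k : nat) :
  Sigma sigma -> sends sigma x x' -> multiplicity_le Sigma k -> (0 < k)%N.
Proof.
move=> Sigma_sigma sigma_xx' /(_ x x'); case: k => // le0.
have : [set s | Sigma s /\ sends s x x'] = set0.
  by apply/(@card_le0P _ nat); move: le0; rewrite II0.
by move/seteqP => [/(_ sigma)]; case.
Qed.

(** The diagonal pair (x, x) lies in some translation as 0 < r, so transitivity
    produces a cotranslation fixing x. *)
Lemma atlas_multiplicity_gt0 (R : realType) (X : metricType R) (A : atlas X)
    (r : R) (k : nat) :
  [set: X] !=set0 -> 0 < r -> multiplicity_le (cotranslations A r) k ->
  (0 < k)%N.
Proof.
move=> [x _] r_gt0.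
have [t At txx] : exists2 t, translations A r t & t (x, x).
  by apply: atlas_cover => //; rewrite mdistxx.
have [sigma Asigma [sxx _]] := atlas_transitive r_gt0 At txx txx.
exact: multiplicity_gt0 Asigma sxx.
Qed.

Lemma atlas_k_gt0 (R : realType) (X : metricType R) (A : atlas X) (r : R) :
  [set: X] !=set0 -> 0 < r -> (0 < atlas_k A r)%N.
Proof.
move=> X0 r_gt0; apply: (atlas_multiplicity_gt0 (A := A) X0 r_gt0).
exact: (nat_min_spec (atlas_multiplicity A r_gt0)).1.
Qed.

Section PulledBackTranslations.
Context (X : Type) (G : groupType) (phi : X -> G).

Definition right_orbit (h : G) : set (X * X) :=
  [set p | phi p.2 = (phi p.1 * h)%g].

Definition left_transport (g : G) : set (X * X) :=
  [set p | phi p.1 = (g * phi p.2)%g].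

Lemma right_orbitP (x y : X) : right_orbit ((phi x)^-1 * phi y)%g (x, y).
Proof. by rewrite /right_orbit /= mulVKg. Qed.

Lemma right_orbit_step (h : G) (x y : X) :
  right_orbit h (x, y) -> h = ((phi x)^-1 * phi y)%g.
Proof. by rewrite /right_orbit /= => ->; rewrite mulKg. Qed.

Lemma left_transport_factor (g : G) (x x' : X) :
  sends (left_transport g) x x' -> g = (phi x' * (phi x)^-1)%g.
Proof. by rewrite /sends /left_transport /= => ->; rewrite mulgK. Qed.

(** The left and right actions commute. *)
Lemma left_transport_orbit (g h : G) (x y x' y' : X) :
  right_orbit h (x, y) -> sends (left_transport g) x x' ->
  sends (left_transport g) y y' -> right_orbit h (x', y').
Proof.
by rewrite /sends /right_orbit /left_transport /= => -> -> ->; rewrite mulgA.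
Qed.

Lemma left_transport_transitive (h : G) (x y x' y' : X) :
  right_orbit h (x, y) -> right_orbit h (x', y') ->
  exists g : G, sends (left_transport g) x x' /\
                sends (left_transport g) y y'.
Proof.
rewrite /sends /right_orbit /left_transport /= => hxy hxy'.
exists (phi x' * (phi x)^-1)%g; split; first by rewrite mulgVK.
by rewrite hxy hxy' mulgA mulgVK.
Qed.

(** The left action is free, so one value of a transport determines it. *)
Lemma left_transport_multiplicity :
  multiplicity_le (range left_transport) 1.
Proof.
move=> x x'; pose g0 := (phi x' * (phi x)^-1)%g.
rewrite -(card_le_eqr (@card_set1 _ (left_transport g0))).
apply: subset_card_le => _ [[g _ <-] /= /left_transport_factor g_eq].
by rewrite /g0 -g_eq.
Qed.

Context (phi_inj : injective phi).

Lemma right_orbit_partial_bijection (h : G) :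
  partial_bijection (right_orbit h).
Proof.
split=> -[x y] [x' y'] /set_mem + /set_mem +; rewrite /right_orbit /=.
  by move=> hxy hxy' xx'; rewrite -xx' -hxy in hxy' *; rewrite (phi_inj hxy').
move=> hxy hxy' yy'; rewrite -yy' hxy in hxy' *.
by move/mulIg/phi_inj: hxy' => ->.
Qed.

Lemma left_transport_partial_bijection (g : G) :
  partial_bijection (left_transport g).
Proof.
split=> -[x y] [x' y'] /set_mem + /set_mem +; rewrite /left_transport /=.
  move=> gxy gxy' xx'; rewrite -xx' gxy in gxy' *.
  by move/mulgI/phi_inj: gxy' => ->.
by move=> gxy gxy' yy'; rewrite -yy' -gxy in gxy' *; rewrite (phi_inj gxy').
Qed.

End PulledBackTranslations.

Lemma sub_partial_translation (R : numDomainType) (X : metricType R)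
    (s t : set (X * X)) :
  s `<=` t -> partial_translation t -> partial_translation s.
Proof.
move=> st [[t_fst t_snd] [C tC]]; split; last by exists C => x y /st/tC.
by split=> p q /set_mem/st/mem_set tp /set_mem/st/mem_set tq;
  [exact: t_fst|exact: t_snd].
Qed.

Section GroupAtlas.
Context (R : realType) (X : metricType R) (G : metricGroupType R).
Context (G_discrete : countable_discrete G) (G_proper : proper_metric G).
Context (G_invariant : left_invariant G).
Context (phi : X -> G) (phi_inj : injective phi).
Context (phi_unif : uniform_embedding phi).

Lemma right_orbit_displacement (h : G) (x y : X) :
  right_orbit phi h (x, y) -> mdist (phi x) (phi y) = mdist 1%g h.
Proof.
by rewrite /right_orbit /= => ->; rewrite -{1}[phi x]mulg1 G_invariant.
Qed.

(** The displacement is constant in G, and the lower control of the embedding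
    bounds it back in X. *)
Lemma right_orbit_partial_translation (h : G) :
  partial_translation (right_orbit phi h).
Proof.
split; first exact: right_orbit_partial_bijection.
have [s phi_s] := phi_unif.2 (mdist 1%g h); exists s => x y hxy.
by apply: phi_s; rewrite (right_orbit_displacement hxy).
Qed.

(** Asking for a pair at distance < r is what keeps this family finite. *)
Definition group_translations (r : R) : set (set (X * X)) :=
  [set right_orbit phi h | h in
    [set h | exists x y, right_orbit phi h (x, y) /\ mdist x y < r]].

(** The upper control of the embedding confines the relevant h to a fixed ball
    of G. *)
Lemma group_translations_finite (r : R) : finite_set (group_translations r).
Proof.
have [s phi_s] := phi_unif.1 r.
apply: finite_image; apply: sub_finite_set
  (proper_discrete_ball_finite s G_discrete G_proper).
move=> h [x [y [hxy /ltW xy_r]]] /=.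
by rewrite -(right_orbit_displacement hxy); exact: phi_s.
Qed.

Lemma group_translations_disjoint (r : R) : trivIset (group_translations r) id.
Proof.
move=> _ _ [h _ <-] [h' _ <-] [[x y] [/= hxy h'xy]].
by rewrite (right_orbit_step hxy) (right_orbit_step h'xy).
Qed.

Lemma group_translations_cover (r : R) (x y : X) :
  mdist x y < r -> exists2 t, group_translations r t & t (x, y).
Proof.
move=> xy_r; have hxy := right_orbitP phi x y.
exists (right_orbit phi ((phi x)^-1 * phi y)%g) => //.
by eexists => //; exists x, y.
Qed.

Definition group_atlas : atlas X.
Proof.
apply: (@Atlas R X group_translations (fun=> range (left_transport phi))).
- by move=> r _; exact: group_translations_finite.
- by move=> r _ _ [h _ <-]; exact: right_orbit_partial_translation.
- by move=> r _; exact: group_translations_disjoint.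
- move=> r _ _ [g _ <-]; split; first exact: left_transport_partial_bijection.
  by move=> _ [h _ <-] x y x' y'; exact: left_transport_orbit.
- by move=> r _; exact: group_translations_cover.
- by move=> r _; exists 1%N; exact: left_transport_multiplicity.
- move=> r _ _ [h _ <-] x y x' y' hxy hxy'.
  have [g gP] := left_transport_transitive hxy hxy'.
  by exists (left_transport phi g) => //; exists g.
Defined.

Lemma group_atlas_free : [set: X] !=set0 -> free_atlas group_atlas.
Proof.
move=> X_nonempty r r_gt0; apply: nat_min_eq1 => [k|].
  exact: atlas_multiplicity_gt0 X_nonempty r_gt0.
exact: left_transport_multiplicity.
Qed.

Lemma group_atlas_globally_controlled : globally_controlled group_atlas.
Proof.
move=> r _ x y; apply: sub_partial_translation
  (right_orbit_partial_translation ((phi x)^-1 * phi y)%g).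
move=> [x' y'] [_ [g _ <-] [/= gx gy]].
exact: left_transport_orbit (right_orbitP phi x y) gx gy.
Qed.

End GroupAtlas.

Theorem theorem19 (R : realType) (X : metricType R)
    (X_nonempty : [set: X] !=set0)
    (X_discrete : uniformly_discrete X) (X_bounded : bounded_geometry X)
    (G : metricGroupType R) (G_discrete : countable_discrete G)
    (G_proper : proper_metric G) (G_invariant : left_invariant G)
    (phi : X -> G) (phi_inj : injective phi)
    (phi_unif : uniform_embedding phi) :
  (exists2 A : atlas X, free_atlas A & globally_controlled A) /\
  (forall r : R, 0 < r -> kappa X r = 1%N).
Proof.
pose A := group_atlas G_discrete G_proper G_invariant phi_inj phi_unif.
have A_free : free_atlas A by exact: group_atlas_free.
split; first by exists A => //; exact: group_atlas_globally_controlled.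
move=> r r_gt0; apply: nat_min_eq1 => [_ [B _ <-]|]; first exact: atlas_k_gt0.
by exists A => //; exact: A_free.
Qed.
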